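(* Let $\beta>0$, $0<r\le2$, $\gamma\ge0$, $L>0$ be fixed. For $\epsilon>0$ let the observations be $Y_i=\theta_i+\epsilon\,\xi_i$, $i\ge 1$, where the $\xi_i$ are independent Gaussian random variables with mean $0$ and variance $\sigma_i^2=i^{2\gamma}$. Let $Q(\theta)=\sum_{i=1}^\infty\theta_i^2$ and $$\Sigma(\beta,r,L)=\Big\{\theta=(\theta_i)_{i\ge1}:\ \sum_{i=1}^\infty e^{2\beta i^r}\theta_i^2\le L\Big\}.$$ Consider the estimator $$\widetilde Q=\sum_{i=1}^\infty h_i\,(Y_i^2-\epsilon^2\sigma_i^2),\qquad h_i=\Big(1-\frac{e^{2\beta i^r}}{e^{2\beta W^r}}\Big)_+,$$ where $W$ is a solution of the equation $$W^{4\gamma+(1-r)_+}\exp\big(4\beta W^r-2\beta r W^{r-1}I_{(r>1)}\big)=c\,\epsilon^{-4},$$ with the constant $c=c(\beta,r,\gamma,L)$ given by $c=2\beta rL^2$ if $0<r<1$, $c=L^2(e^{4\beta}-1)/(2e^{2\beta})$ if $r=1$, $c=L^2/2$ if $1<r<2$, and $c=L^2/(2e^{2\beta})$ if $r=2$. Then, as $\epsilon\to0$, $$\sup_{\theta\in\Sigma(\beta,r,L)}E\Big[\big(\widetilde Q-Q(\theta)\big)^2-4\epsilon^2\sum_{i=1}^\infty\sigma_i^2\theta_i^2\Big]=\frac{2\epsilon^4}{4\gamma+1}\left(\frac{\log(1/\epsilon)}{\beta}\right)^{(4\gamma+1)/r}(1+o(1)).$$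
   Context: $(x)_+=\max(x,0)$, and $I_{(r>1)}$ equals $1$ if $r>1$ and $0$ otherwise. $W=W(\epsilon)$ is a positive real number (not necessarily an integer). The expectation $E$ is with respect to the law of the observations $(Y_i)_{i\ge1}$ when the true signal is $\theta$. The term $o(1)$ denotes a quantity tending to $0$ as $\epsilon\to0$ with $\beta,r,\gamma,L$ fixed. Since $h_i=0$ for $i\ge W$, the sum defining $\widetilde Q$ is finite. *)

(* Defs.v *)
From HB Require Import structures.
From mathcomp Require Import all_boot all_order all_algebra finmap.
From mathcomp Require Import all_classical all_reals all_analysis.

Set Implicit Arguments.
Unset Strict Implicit.
Unset Printing Implicit Defensive.

Import Order.TTheory GRing.Theory Num.Theory.
Import numFieldNormedType.Exports.

Local Open Scope classical_set_scope.
Local Open Scope ring_scope.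

(* Sequences are functions on [nat] of which only the values at indices
   [i >= 1] are ever used. *)

Section independence.
Context d (T : measurableType d) (R : realType) (P : probability T R).

(* Every finite subfamily of [(X i)_(i in D)] satisfies the product rule. *)
Definition mutual_independence (D : set nat) (X : nat -> {RV P >-> R}) : Prop :=
  forall (J : {fset nat}) (A : nat -> set R),
    (forall i, i \in J -> D i) ->
    (forall i, i \in J -> measurable (A i)) ->
    P (\bigcap_(i in [set` J]) (X i @^-1` A i)) =
      (\prod_(i <- J) P (X i @^-1` A i))%E.

End independence.

Section sequence_model.
Context (R : realType).
Implicit Types (beta r gamma L W e : R) (theta : nat -> R).

(* The limit of the partial sums in [R]; it is meaningful only for convergent
   series, which is the case of all the sums below when
   [theta] is in [Sigma beta r L]. *)
Definition rsum (u : nat -> R) : R := \big[+%R/0]_(1 <= i <oo) u i.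

(* The standard deviation [i ^ gamma], so that the variance
   is [i ^ (2 gamma)]. *)
Definition sigma gamma (i : nat) : R := i%:R `^ gamma.

Definition Q theta : R := rsum (fun i => theta i ^+ 2).

(* The sum is taken in the extended reals, hence is [+oo] if it diverges. *)
Definition Sigma beta r L : set (nat -> R) :=
  [set theta |
    (\sum_(1 <= i <oo)
       (expR (2 * beta * i%:R `^ r) * theta i ^+ 2)%:E <= L%:E)%E].

Definition h beta r W (i : nat) : R :=
  Num.max (1 - expR (2 * beta * i%:R `^ r) / expR (2 * beta * W `^ r)) 0.

Definition Qtilde beta r gamma W e (y : nat -> R) : R :=
  rsum (fun i => h beta r W i * (y i ^+ 2 - e ^+ 2 * sigma gamma i ^+ 2)).

(* The cases are those of [0 < r <= 2]. *)
Definition cst_W beta r L : R :=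
  if r < 1 then 2 * beta * r * L ^+ 2
  else if r == 1 then L ^+ 2 * (expR (4 * beta) - 1) / (2 * expR (2 * beta))
  else if r < 2 then L ^+ 2 / 2
  else L ^+ 2 / (2 * expR (2 * beta)).

Definition W_equation beta r gamma L e W : Prop :=
  W `^ (4 * gamma + Num.max (1 - r) 0) *
    expR (4 * beta * W `^ r
          - 2 * beta * r * W `^ (r - 1) * (if 1 < r then 1 else 0))
  = cst_W beta r L * e ^- 4.

End sequence_model.

Section risk.
Context d (T : measurableType d) (R : realType) (P : probability T R).

Definition observation (xi : nat -> {RV P >-> R}) (e : R) (theta : nat -> R)
    (w : T) (i : nat) : R :=
  theta i + e * xi i w.

Definition centered_risk (xi : nat -> {RV P >-> R}) (beta r gamma W e : R)
    (theta : nat -> R) : \bar R :=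
  ('E_P[(fun w =>
     (Qtilde beta r gamma W e (observation xi e theta w) - Q theta) ^+ 2
     - 4 * e ^+ 2 * rsum (fun i => sigma gamma i ^+ 2 * theta i ^+ 2))%R])%E.

End risk.

(* Main.v *)
Require Import Defs.
From HB Require Import structures.
From mathcomp Require Import all_boot all_order all_algebra finmap.
From mathcomp Require Import ring lra.
From mathcomp Require Import all_classical all_reals all_analysis.
From mathcomp Require Import measurable_realfun.

Set Implicit Arguments.
Unset Strict Implicit.

Import Order.TTheory GRing.Theory Num.Theory.
Import numFieldNormedType.Exports.

Local Open Scope classical_set_scope.
Local Open Scope ring_scope.

(** The risk can be computed exactly.  Put [h i] for the weights, [s i] for
    the standard deviations and [b = sum h i * theta i ^ 2 - Q theta] for the
    bias.  The estimation error is [b] plus the sum of the variables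
    [2 * h i * e * theta i * xi i + h i * e ^ 2 * (xi i ^ 2 - s i ^ 2)], which
    are centered and pairwise uncorrelated, so that the centered risk is
      [b ^ 2 + 2 * e ^ 4 * sum h i ^ 2 * s i ^ 4
         - 4 * e ^ 2 * sum (1 - h i ^ 2) * s i ^ 2 * theta i ^ 2]
    ([centered_risk_eq]).  The only probabilistic inputs are the first four
    moments of the normal law ([normal_moment_rec]) and the product rule for
    expectations of independent variables ([expectation_mul_indep]).

    The supremum over the ellipsoid is then squeezed without looking for a
    least favourable signal.  The null signal belongs to the ellipsoid and has
    risk [V = 2 * e ^ 4 * sum h i ^ 2 * s i ^ 4].  For any other signal the
    last term is at most [0], and [1 - h i] is at most
    [exp (2 beta i ^ r) / exp (2 beta W ^ r)], whence
    [b ^ 2 <= L ^ 2 * exp (- 4 beta W ^ r)].  So the supremum lies between [V]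
    and [V + L ^ 2 * exp (- 4 beta W ^ r)] ([sup_centered_risk_bounds]).

    It remains to let [e] tend to [0].  The equation for [W] forces [W] to
    infinity, its logarithm gives [beta * W ^ r ~ ln (1 / e)]
    ([bandwidth_equiv]), and substituting it into the bias bound shows that
    the latter is [e ^ 4 * W ^ (4 gamma + 1)] times a negative power of [W]
    ([bias_negligible]).  Since the weights are close to [1] for all but a
    vanishing proportion of the indices below [W], the sum in [V] is equivalent
    to [W ^ (4 gamma + 1) / (4 gamma + 1)] ([noise_equiv]), and the claim
    follows on replacing [W ^ r] by [ln (1 / e) / beta]. *)

(** * Integrals against a normal law and over the line *)

Section normal_integrals.
Context {R : realType}.
Local Notation mu := (@lebesgue_measure R).

(** The density is almost everywhere the Radon-Nikodym derivative, by uniqueness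
    of the latter. *)
Lemma integral_normal_prob (m s : R) (f : R -> \bar R) :
  (normal_prob m s).-integrable setT f ->
  (\int[normal_prob m s]_x f x = \int[mu]_x (f x * (normal_pdf m s x)%:E))%E.
Proof.
move=> intf; have dom := normal_prob_dominates m s.
rewrite -(Radon_Nikodym_change_of_variables dom)//=.
have mf := measurable_int _ intf.
apply: ae_eq_integral => //.
- apply: emeasurable_funM => //; apply: (measurable_int mu).
- apply: emeasurable_funM => //=; apply/measurable_EFinP.
  exact: measurable_normal_pdf.
- apply: ae_eqe_mul2l => /=.
  rewrite Radon_NikodymE.
  case: cid => /= h [h1 h2 h3].
  apply: integral_ae_eq => //=.
  + by apply/measurableT_comp =>//; exact: measurable_normal_pdf.
  + by move=> E E01 mE; rewrite -h3.
Qed.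

(** The change of density formula above presupposes integrability; it applies
    to the truncations of [|f|], which are bounded, and the conclusion passes
    to the limit by monotone convergence. *)
Lemma integrable_normal_prob (m s : R) (f : R -> R) :
  measurable_fun setT f ->
  mu.-integrable setT (fun x => (f x * normal_pdf m s x)%:E) ->
  (normal_prob m s).-integrable setT (EFin \o f).
Proof.
move=> mf intf.
pose g (n : nat) x : \bar R := (Num.min `|f x| n%:R)%:E.
have mg n : measurable_fun setT (g n).
  apply/measurable_EFinP; apply: measurable_funTS.
  apply: measurable_minr => //; exact: measurableT_comp.
have g0 n x : (0 <= g n x)%E by rewrite lee_fin le_min normr_ge0 ler0n.
have ndg x : {homo g^~ x : n k / (n <= k)%N >-> (n <= k)%E}.
  by move=> n k nk; rewrite lee_fin le_min !ge_min lexx/= ler_nat nk orbT.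
have limg x : limn (g^~ x) = `|f x|%:E.
  apply/cvg_lim => //; apply: cvg_near_cst.
  near=> n; congr (_%:E); apply/min_idPl.
  rewrite (le_trans (ltW (truncnS_gt _)))// ler_nat.
  by near: n; exact: nbhs_infty_ge.
apply/integrableP; split; first exact/measurable_EFinP.
have -> : (\int[normal_prob m s]_x `|(EFin \o f) x|)%E =
    limn (fun n => \int[normal_prob m s]_x g n x)%E.
  transitivity (\int[normal_prob m s]_x limn (g^~ x))%E.
    by apply: eq_integral => x _; rewrite limg.
  by rewrite monotone_convergence// => x _; exact: ndg.
have /integrableP[mfp ifoo] := intf.
apply: le_lt_trans ifoo; apply: lime_le.
  apply: ereal_nondecreasing_is_cvgn => n k nk.
  by apply: ge0_le_integral => //; [exact: mg..|move=> x _; exact: ndg].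
apply: nearW => n.
have gint : (normal_prob m s).-integrable setT (g n).
  apply: (@le_integrable _ _ _ _ _ _ _ (EFin \o cst n%:R)) => //.
    exact: mg.
    move=> x _ /=; rewrite lee_fin ger0_norm; last by rewrite -lee_fin; exact: g0.
    by rewrite [leRHS]ger0_norm// ge_min lexx orbT.
  exact: finite_measure_integrable_cst.
rewrite integral_normal_prob//; apply: ge0_le_integral => //=.
- by move=> x _; rewrite mule_ge0// lee_fin normal_pdf_ge0.
- apply: emeasurable_funM; first exact: mg.
  by apply/measurable_EFinP; exact: measurable_normal_pdf.
- apply/measurable_EFinP; apply: measurableT_comp => //.
  exact/measurable_EFinP.
- move=> x _; rewrite -EFinM lee_fin normrM (ger0_norm (normal_pdf_ge0 _ _ _)).
  by rewrite ler_wpM2r ?normal_pdf_ge0// ge_min lexx.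
Unshelve. all: by end_near. Qed.

(** The integrals over [[-n, n]] are [F n - F (- n)] by the fundamental theorem
    of calculus, and they converge to the integral over the line by dominated
    convergence.  This form of integration by parts asks nothing of the sign of
    [f]. *)
Lemma integralT_derive0 (f F : R -> R) :
  mu.-integrable setT (EFin \o f) -> continuous f ->
  (forall x : R, is_derive x 1 F (f x)) ->
  F n%:R - F (- n%:R) @[n --> \oo] --> 0 ->
  (\int[mu]_x (f x)%:E = 0)%E.
Proof.
move=> intf cf dF F0.
pose g (n : nat) : R -> \bar R := (EFin \o f) \_ `[(- n%:R), n%:R].
have mf := measurable_int _ intf.
have [|||||_ _ gcvg] := @dominated_convergence _ _ _ mu setT measurableT g
    (EFin \o f) (abse \o (EFin \o f)).
- move=> n; apply/(measurable_restrictT _ _).1 => //.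
  exact: measurable_funTS.
- exact: mf.
- apply: aeW => x _; apply: cvg_near_cst; near=> n.
  rewrite /g patchE ifT// inE/= in_itv/= -ler_norml.
  rewrite (le_trans (ltW (truncnS_gt _)))// ler_nat.
  by near: n; exact: nbhs_infty_ge.
- exact: integrable_abse.
- apply: aeW => x n _; rewrite /g patchE; case: ifP => // _.
  by rewrite /= normr0 lee_fin.
apply: cvg_unique gcvg _ => //.
have : (F n%:R - F (- n%:R))%:E @[n --> \oo] --> 0%:E by apply: cvg_EFin => //; exact: nearW.
apply: cvg_trans; apply: near_eq_cvg; near=> n.
have n0 : (- n%:R < n%:R :> R).
  by rewrite gtrN// ltr0n; near: n; exact: nbhs_infty_gt.
rewrite /= /g -integral_mkcond (@continuous_FTC2 _ f F)//.
- by apply: continuous_subspaceT.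
- have dFx (x : R) : derivable F x 1 by case: (dF x).
  have cF (x : R) : {for x, continuous F}.
    exact/differentiable_continuous/derivable1_diffP.
  split => //.
  + by apply: cvg_at_right_filter; exact: cF.
  + by apply: cvg_at_left_filter; exact: cF.
- by move=> x _; rewrite derive1E; case: (dF x).
Unshelve. all: by end_near. Qed.

End normal_integrals.

(** * Moments of the centered normal law *)

Section gaussian_moments.
Context {R : realType}.
Local Notation mu := (@lebesgue_measure R).

Lemma normal_pdf_peakE (m s x : R) : s != 0 ->
  normal_pdf m s x = normal_peak s * normal_fun m s x.
Proof. by move=> s0; rewrite normal_pdfE. Qed.

(** The [n]-th power of [|x| / n <= exp (|x| / n)]. *)
Lemma normr_exprn_le_expR n (x : R) : `|x| ^+ n <= n%:R ^+ n * expR `|x|.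
Proof.
case: n => [|n]; first by rewrite !expr0 mul1r (le_trans _ (expR_ge1Dx _))// lerDl.
have -> : `|x| = n.+1%:R * (`|x| / n.+1%:R) by rewrite mulrCA divff ?mulr1.
rewrite expRM_natl -exprMn lerXn2r ?nnegrE ?mulr_ge0 ?divr_ge0 ?expR_ge0//.
by rewrite ler_wpM2l// (le_trans _ (expR_ge1Dx _))// lerDr.
Qed.

(** Doubling the standard deviation absorbs any power of [x]; this gives both
    the integrability of the moments and the decay at infinity needed to
    integrate by parts. *)
Lemma normal_pdf_moment_le n (s : R) : s != 0 ->
  exists C, 0 <= C /\
    forall x : R, `|x ^+ n * normal_pdf 0 s x| <= C * normal_pdf 0 (2 * s) x.
Proof.
move=> s0; have s20 : 2 * s != 0 by rewrite mulf_neq0.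
have ss : 0 < s ^+ 2 by rewrite exprn_even_gt0.
pose K := n%:R ^+ n * expR (s ^+ 2).
exists (K * normal_peak s / normal_peak (2 * s)).
have K0 : 0 <= K by rewrite mulr_ge0 ?expR_ge0 ?exprn_ge0.
split=> [|x]; first by rewrite !mulr_ge0 ?invr_ge0 ?normal_peak_ge0.
rewrite normrM (ger0_norm (normal_pdf_ge0 _ _ _)) !normal_pdf_peakE//.
rewrite [leLHS]mulrCA [leRHS](_ : _ = normal_peak s * (K * normal_fun 0 (2 * s) x)); last first.
  by field; rewrite gt_eqF ?normal_peak_gt0.
rewrite ler_wpM2l ?normal_peak_ge0// normrX.
rewrite (le_trans (ler_wpM2r (normal_fun_ge0 _ _ _) (normr_exprn_le_expR n x)))//.
rewrite /K -!mulrA ler_wpM2l ?exprn_ge0// /normal_fun -!expRD ler_expR !subr0.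
have -> : - x ^+ 2 / (s ^+ 2 *+ 2) = - (`|x| ^+ 2 / s ^+ 2) / 2.
  by rewrite real_normK ?num_real//; field; rewrite s0.
have -> : - x ^+ 2 / ((2 * s) ^+ 2 *+ 2) = - (`|x| ^+ 2 / s ^+ 2) / 8.
  by rewrite real_normK ?num_real//; field; rewrite s0.
(* With [t = |x| / s], what remains is [t * s <= s ^ 2 + 3 / 8 * t ^ 2]. *)
have [t tE] : exists t, `|x| = t * s by exists (`|x| / s); rewrite mulfVK.
rewrite tE exprMn mulfK ?gt_eqF//.
have := sqr_ge0 (s - t / 2); have := sqr_ge0 t.
lra.
Qed.

Lemma integrable_exprn_normal_pdf n (s : R) : s != 0 ->
  mu.-integrable setT (fun x : R => (x ^+ n * normal_pdf 0 s x)%:E).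
Proof.
move=> s0; have [C [C0 leC]] := normal_pdf_moment_le n s0.
have : mu.-integrable setT (fun x : R => (C%:E * (normal_pdf 0 (2 * s) x)%:E)%E).
  by apply: integrableZl => //; exact: integrable_normal_pdf.
apply: le_integrable => //.
- apply/measurable_EFinP; apply: measurable_funM => //.
  exact: measurable_normal_pdf.
- move=> x _; rewrite -EFinM lee_fin [leRHS]ger0_norm ?leC//.
  by rewrite mulr_ge0// normal_pdf_ge0.
Qed.

Lemma integrable_exprn_normal n (s : R) : s != 0 ->
  (normal_prob 0 s).-integrable setT (fun x : R => (x ^+ n)%:E).
Proof.
move=> s0; apply: (@integrable_normal_prob R 0 s (fun x => x ^+ n)) => //.
exact: integrable_exprn_normal_pdf.
Qed.

(** The factor [s ^ 2] clears the denominator coming from the derivative of the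
    exponent.  For [n = 0] the junk value [n.-1 = 0] is harmless, being
    multiplied by [n%:R]. *)
Lemma is_derive_exprn_normal_pdf n (s x : R) : s != 0 ->
  is_derive x 1 (fun x : R => s ^+ 2 * (x ^+ n * normal_pdf 0 s x))
    ((s ^+ 2 * n%:R * x ^+ n.-1 - x ^+ n.+1) * normal_pdf 0 s x).
Proof.
move=> s0; have ss0 : s ^+ 2 != 0 by rewrite expf_neq0.
pose c : R := - (s ^+ 2 *+ 2)^-1.
have -> : (fun x : R => s ^+ 2 * (x ^+ n * normal_pdf 0 s x)) =
    (s ^+ 2 * normal_peak s) *: ((@id R) ^+ n * (expR \o (c *: (@id R) ^+ 2))).
  apply/funext => y; rewrite normal_pdf_peakE// /normal_fun subr0 /c !fctE /GRing.scale/=.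
  have -> : - y ^+ 2 / (s ^+ 2 *+ 2) = - (s ^+ 2 *+ 2)^-1 * y ^+ 2.
    by rewrite mulNr mulNr mulrC.
  ring.
have dX k : is_derive x 1 ((@id R) ^+ k) (k%:R * x ^+ k.-1).
  by apply: is_derive_eq; rewrite /GRing.scale/= mulr1.
have de : is_derive x 1 (expR \o (c *: (@id R) ^+ 2))
    (expR (c * x ^+ 2) * (c * (2 * x))).
  apply: is_derive1_comp.
apply: is_derive_eq.
rewrite normal_pdf_peakE// /normal_fun subr0 /GRing.scale/= !fctE.
have -> : - x ^+ 2 / (s ^+ 2 *+ 2) = c * x ^+ 2 by rewrite /c mulNr mulNr mulrC.
rewrite (_ : c *: x ^+ 2 = c * x ^+ 2)// (exprS x n) /c; field.
by rewrite s0.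
Qed.

Lemma normal_pdf_moment_bound n (s : R) : s != 0 ->
  exists K, forall x : R, `|x ^+ n * normal_pdf 0 s x| <= K.
Proof.
move=> s0; have [C [C0 leC]] := normal_pdf_moment_le n s0.
exists (C * normal_peak (2 * s)) => x; rewrite (le_trans (leC x))//.
by rewrite ler_wpM2l// normal_pdf_ub// mulf_neq0.
Qed.

(** Gaussian integration by parts: integrate the derivative of
    [s ^ 2 * x ^ n * normal_pdf 0 s x], which vanishes at both infinities. *)
Lemma normal_moment_rec n (s : R) : s != 0 ->
  (\int[normal_prob 0 s]_x (x ^+ n.+1)%:E =
   (s ^+ 2 * n%:R)%:E * \int[normal_prob 0 s]_x (x ^+ n.-1)%:E)%E.
Proof.
move=> s0.
have iX k := integrable_exprn_normal_pdf k s0.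
have iN k := integrable_exprn_normal k s0.
rewrite !integral_normal_prob//.
under eq_integral do rewrite -EFinM.
under [X in (_ * X)%E]eq_integral do rewrite -EFinM.
have fX k : (\int[mu]_x (x ^+ k * normal_pdf 0 s x)%:E)%E \is a fin_num.
  by apply: integrable_fin_num => //; exact: iX.
suff : ((s ^+ 2 * n%:R)%:E * \int[mu]_x (x ^+ n.-1 * normal_pdf 0 s x)%:E -
    \int[mu]_x (x ^+ n.+1 * normal_pdf 0 s x)%:E = 0)%E.
  move/eqP; rewrite sube_eq ?fin_numM ?fin_num_adde_defl//.
  by rewrite add0e => /eqP ->.
rewrite -integralZl//.
rewrite -integralB//; last exact: integrableZl.
pose f (x : R) := (s ^+ 2 * n%:R * x ^+ n.-1 - x ^+ n.+1) * normal_pdf 0 s x.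
have fE : (fun x : R => (s ^+ 2 * n%:R)%:E * (x ^+ n.-1 * normal_pdf 0 s x)%:E -
    (x ^+ n.+1 * normal_pdf 0 s x)%:E)%E = EFin \o f.
  by apply/funext => x; rewrite -EFinM -EFinB /= /f mulrBl mulrA.
rewrite fE.
pose F (x : R) := s ^+ 2 * (x ^+ n * normal_pdf 0 s x).
apply: (@integralT_derive0 R f F).
- rewrite -fE; apply: integrableB => //; exact: integrableZl.
- move=> x; rewrite /f; apply: cvgM; last exact: continuous_normal_pdf.
  apply: cvgB; last exact: exprn_continuous.
  by apply: cvgM; [exact: cvg_cst|exact: exprn_continuous].
- by move=> x; exact: is_derive_exprn_normal_pdf.
(* One more power of [x] than needed is bounded, so [F x = O(1 / x)]. *)
have [K leK] := normal_pdf_moment_bound n.+1 s0.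
have K0 : 0 <= K by rewrite (le_trans _ (leK 0)).
have FK (x : R) : `|x| * `|F x| <= s ^+ 2 * K.
  rewrite /F -normrM mulrCA normrM ger0_norm ?sqr_ge0// ler_wpM2l ?sqr_ge0//.
  by rewrite mulrA -exprS.
apply/cvgrPdist_le => e e0; near=> k.
rewrite sub0r normrN.
have k0 : 0 < k%:R :> R by rewrite ltr0n; near: k; exact: nbhs_infty_gt.
rewrite -(ler_pM2l k0) (le_trans (ler_wpM2l (ltW k0) (ler_normB _ _)))//.
have := FK k%:R; have := FK (- k%:R); rewrite normrN ger0_norm ?(ltW k0)//.
rewrite mulrDr => F1 F2; rewrite (le_trans (lerD F2 F1))// -ler_pdivrMr//.
rewrite (le_trans (ltW (truncnS_gt _)))// ler_nat.
by near: k; exact: nbhs_infty_ge.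
Unshelve. all: by end_near. Qed.

Lemma normal_moment0 (s : R) : (\int[normal_prob 0 s]_x (x ^+ 0)%:E = 1)%E.
Proof.
under eq_integral do rewrite expr0.
by rewrite integral_cst//= mul1e probability_setT.
Qed.

Lemma normal_moment1 (s : R) : s != 0 ->
  (\int[normal_prob 0 s]_x (x ^+ 1)%:E = 0)%E.
Proof. by move=> s0; rewrite (normal_moment_rec 0)// mulr0 mul0e. Qed.

Lemma normal_moment2 (s : R) : s != 0 ->
  (\int[normal_prob 0 s]_x (x ^+ 2)%:E = (s ^+ 2)%:E)%E.
Proof.
by move=> s0; rewrite (normal_moment_rec 1)// normal_moment0 mule1 mulr1.
Qed.

Lemma normal_moment3 (s : R) : s != 0 ->
  (\int[normal_prob 0 s]_x (x ^+ 3)%:E = 0)%E.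
Proof. by move=> s0; rewrite (normal_moment_rec 2)// normal_moment1 ?mule0. Qed.

Lemma normal_moment4 (s : R) : s != 0 ->
  (\int[normal_prob 0 s]_x (x ^+ 4)%:E = (3 * s ^+ 4)%:E)%E.
Proof.
move=> s0; rewrite (normal_moment_rec 3)// normal_moment2// -EFinM.
congr (_%:E); ring.
Qed.

End gaussian_moments.

(** * Independence and second moments of sums *)

Section independence.
Context d (T : measurableType d) (R : realType) (P : probability T R).

(** Independence says that the law of [(X, Y)] is the product of the marginal
    laws, because a measure on the product is determined by its values on
    rectangles; the conclusion is then Fubini's theorem. *)
Lemma expectation_mul_indep (X Y : {RV P >-> R}) (f g : R -> R) :
  (forall A B, measurable A -> measurable B ->
    P (X @^-1` A `&` Y @^-1` B) = (P (X @^-1` A) * P (Y @^-1` B))%E) ->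
  measurable_fun setT f -> measurable_fun setT g ->
  (f \o X) \in Lfun P 1 -> (g \o Y) \in Lfun P 1 ->
  ((f \o X) * (g \o Y))%R \in Lfun P 1 ->
  ('E_P[(f \o X) * (g \o Y)] = 'E_P[f \o X] * 'E_P[g \o Y])%E.
Proof.
move=> indep mf mg /Lfun1_integrable fX /Lfun1_integrable gY /Lfun1_integrable fgXY.
pose Z0 w := (X w, Y w).
have mZ : measurable_fun setT Z0 by exact: measurable_fun_pair.
pose Z : {RV P >-> (R * R)%type} := mfun_Sub (mem_set mZ).
pose DX := distribution P X; pose DY := distribution P Y.
have DZ A : measurable A -> (DX \x DY)%E A = distribution P Z A.
  apply: product_measure_unique => B C mB mC.
  rewrite /DX /DY /distribution /= /pushforward -indep//; congr (P _).
pose F (z : R * R) : \bar R := (f z.1 * g z.2)%:E.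
have mF : measurable_fun setT F.
  apply/measurable_EFinP/measurable_funM.
    exact: (measurableT_comp mf measurable_fst).
  exact: (measurableT_comp mg measurable_snd).
have intf : DX.-integrable setT (EFin \o f).
  apply: integrable_pushforward => //; exact/measurable_EFinP.
have intg : DY.-integrable setT (EFin \o g).
  apply: integrable_pushforward => //; exact/measurable_EFinP.
have intF : (DX \x DY)%E.-integrable setT F.
  have /integrableP[_ Foo] : (distribution P Z).-integrable setT F.
    exact: integrable_pushforward.
  apply/integrableP; split=> //.
  rewrite (eq_measure_integral (distribution P Z))// => A mA _.
  exact: DZ.
rewrite unlock.
transitivity (\int[distribution P Z]_z F z)%E.
  by rewrite integral_distribution.
rewrite (eq_measure_integral (DX \x DY)%E); last first.
  by move=> A mA _; exact/esym/DZ.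
rewrite -integral12_prod_meas1//.
transitivity (\int[DX]_x ((f x)%:E * \int[DY]_y (g y)%:E))%E.
  by apply: eq_integral => x _; rewrite -integralZl.
have fing : (\int[DY]_y (g y)%:E)%E \is a fin_num by exact: integrable_fin_num.
rewrite -(fineK fing) integralZr// fineK//.
rewrite -(@integral_distribution _ _ _ _ _ _ X (EFin \o f))//; last exact/measurable_EFinP.
by rewrite -(@integral_distribution _ _ _ _ _ _ Y (EFin \o g))//; exact/measurable_EFinP.
Qed.

End independence.

Section second_moment_of_sums.
Context d (T : measurableType d) (R : realType) (P : probability T R).

(** Converse of [Lfun2_integrable_sqr]. *)
Lemma Lfun2_sqr_integrable (f : T -> R) : measurable_fun setT f ->
  P.-integrable setT (fun w => (f w ^+ 2)%:E) -> f \in Lfun P 2%:E.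
Proof.
move=> mf /integrableP[_ foo].
rewrite inE; apply/andP; split; rewrite inE//=.
rewrite /finite_norm unlock /Lnorm.
apply: poweR_lty; apply: le_lt_trans foo.
apply: ge0_le_integral => //=.
- apply/measurable_EFinP.
  by apply/(@measurableT_comp _ _ _ _ _ _ (fun x : R => x `^ 2)) => //; exact: measurableT_comp.
- by apply/measurable_EFinP; apply: measurableT_comp => //; exact: measurable_funX.
- by move=> x _; rewrite lee_fin normrX powR_mulrn.
Qed.

(** Pythagoras for uncorrelated centered variables, shifted by a constant.  The
    induction carries along that the partial sums are uncorrelated with all the
    later terms. *)
Lemma expectation_sqr_sum (b : R) (Z : nat -> T -> R) (v : nat -> R) n :
  (forall i, Z i \in Lfun P 2%:E) -> (forall i, 'E_P[Z i] = 0)%E ->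
  (forall i j, i != j -> 'E_P[Z i \* Z j] = 0)%E ->
  (forall i, 'E_P[Z i \* Z i] = (v i)%:E)%E ->
  let S := fun w => b + \sum_(i < n) Z i w in
  (S \* S) \in Lfun P 1 /\ ('E_P[S \* S] = (b ^+ 2 + \sum_(i < n) v i)%:E)%E.
Proof.
move=> Z2 EZ EZZ EZv.
have Pfin : P setT \is a fin_num := fin_num_measure P _ measurableT.
pose C k w := b + \sum_(i < k) Z i w.
have CS k : C k.+1 = C k \+ Z k.
  by apply/funext => w; rewrite /C big_ord_recr/= addrA.
have C0 : C 0%N = cst b by apply/funext => w; rewrite /C big_ord0 addr0.
suff H k : [/\ C k \in Lfun P 2%:E,
    forall j, (k <= j)%N -> ('E_P[C k \* Z j] = 0)%E &
    ('E_P[C k \* C k] = (b ^+ 2 + \sum_(i < k) v i)%:E)%E].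
  move=> S; have [C2 _ EC] := H n.
  by split; [exact: Lfun2_mul_Lfun1|].
elim: k => [|k [C2 CZ EC]].
  rewrite C0; split; first exact: Lfun_cst.
    move=> j _; rewrite [X in ('E_P[X])%E](_ : _ = b \o* Z j); last first.
      by apply/funext => w /=; rewrite mulrC.
    by rewrite expectationZl ?EZ ?mule0// Lfun_subset12.
  by rewrite big_ord0 addr0 expr2 -(expectation_cst P (b * b)).
rewrite CS.
have ZZ1 i j : (Z i \* Z j) \in Lfun P 1 by exact: Lfun2_mul_Lfun1.
have CZ1 j : (C k \* Z j) \in Lfun P 1 by exact: Lfun2_mul_Lfun1.
have CC1 : (C k \* C k) \in Lfun P 1 by exact: Lfun2_mul_Lfun1.
split.
- by rewrite rpredD ?lee1n.
- move=> j kj.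
  rewrite [X in ('E_P[X])%E](_ : _ = (C k \* Z j) \+ (Z k \* Z j)); last first.
    by apply/funext => w /=; rewrite mulrDl.
  by rewrite expectationD// CZ ?EZZ ?add0e//; [rewrite ltn_eqF|exact: ltnW].
- rewrite [X in ('E_P[X])%E](_ : _ = (C k \* C k \+ 2 \o* (C k \* Z k)) \+ (Z k \* Z k)); last first.
    by apply/funext => w /=; ring.
  rewrite expectationD ?rpredD ?Lfun_scale// expectationD ?Lfun_scale//.
  rewrite expectationZl// CZ// mule0 adde0 EC EZv -EFinD big_ord_recr/=.
  by rewrite addrA.
Qed.

End second_moment_of_sums.

(** * Quadratic polynomials of a normal variable *)

Section gaussian_chaos.
Context d (T : measurableType d) (R : realType) (P : probability T R).
Variables (s : R) (X : {RV P >-> R}).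
Hypothesis s0 : s != 0.
Hypothesis XN : forall A : set R, measurable A ->
  distribution P X A = normal_prob 0 s A.

(* [R] and [measurableTypeR R] have the same measurable sets but distinct
   displays; [X'] is [X] with values in the type on which [normal_prob] is a
   measure. *)
Let mX : @measurable_fun _ _ T (measurableTypeR R) setT X.
Proof. exact: (measurable_funPT X). Qed.

Let X' : {RV P >-> measurableTypeR R} :=
  @mfun_Sub _ _ T (measurableTypeR R) X (mem_set mX).

Let mexprn k : measurable_fun setT (fun x : measurableTypeR R => x ^+ k).
Proof. exact: (@measurable_funX _ R R setT id k). Qed.

Let integral_X' (f : measurableTypeR R -> \bar R) :
  (\int[distribution P X']_x f x = \int[normal_prob 0 s]_x f x)%E.
Proof. by apply: eq_measure_integral => A mA _; exact: (XN mA). Qed.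

Lemma gaussian_Lfun1_exprn k : (fun w => X w ^+ k) \in Lfun P 1.
Proof.
apply/Lfun1_integrable/integrableP; split.
  by apply/measurable_EFinP; exact: (measurableT_comp (mexprn k) mX).
have <- : (\int[distribution P X']_x `|x ^+ k|%:E = \int[P]_w `|(X w) ^+ k|%:E)%E.
  rewrite ge0_integral_distribution//.
  by apply/measurable_EFinP; exact: (measurableT_comp _ (mexprn k)).
rewrite integral_X'.
by have /integrableP[] := integrable_exprn_normal k s0.
Qed.

Lemma gaussian_expectation_exprn k :
  ('E_P[(fun w => X w ^+ k)%R] = \int[normal_prob 0 s]_x (x ^+ k)%:E)%E.
Proof.
rewrite unlock -integral_X' integral_distribution//.
  by apply/measurable_EFinP; exact: mexprn.
by have /Lfun1_integrable := gaussian_Lfun1_exprn k.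
Qed.

Lemma gaussian_expectation_poly (q : nat -> R) n :
  let f := fun w => \sum_(i < n) q i * X w ^+ i in
  f \in Lfun P 1 /\
  ('E_P[f] = \sum_(i < n) (q i)%:E * 'E_P[(fun w => X w ^+ i)%R])%E.
Proof.
elim: n => [|n [IH1 IH2]] f.
  have -> : f = cst 0 by apply/funext => w; rewrite /f big_ord0.
  by split; [exact: Lfun_cst|rewrite expectation_cst big_ord0].
have -> : f = (fun w => \sum_(i < n) q i * X w ^+ i) \+ (q n \o* (fun w => X w ^+ n)).
  by apply/funext => w; rewrite /f big_ord_recr/= [X in _ + X]mulrC.
have XL := gaussian_Lfun1_exprn n.
split; first by rewrite rpredD ?Lfun_scale.
by rewrite expectationD ?Lfun_scale// expectationZl// IH2 big_ord_recr.
Qed.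

(** The element of the first two Wiener chaoses with coefficients [a] and [c],
    for a normal variable of variance [s ^ 2]; its two parts are orthogonal. *)
Definition chaos (a c x : R) : R := a * x + c * (x ^+ 2 - s ^+ 2).

Lemma measurable_chaos a c : measurable_fun setT (chaos a c).
Proof.
apply: measurable_funD; first exact: measurable_funM.
by apply: measurable_funM => //; apply: measurable_funB.
Qed.

Lemma gaussian_chaos_mean a c : ('E_P[chaos a c \o X] = 0)%E.
Proof.
have [_] := gaussian_expectation_poly (nth 0 [:: - (c * s ^+ 2); a; c]) 3.
rewrite !big_ord_recl big_ord0 /= !gaussian_expectation_exprn.
rewrite normal_moment0 normal_moment1// normal_moment2// mule0 mule1 add0e adde0.
rewrite -!EFinM -!EFinD addNr; apply: etrans; congr expectation.
by apply/funext => w; rewrite !big_ord_recl big_ord0 /= /chaos/=; ring.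
Qed.

(** The cross term is a combination of odd moments; the variance of [X ^ 2] is
    [3 * s ^ 4 - s ^ 4]. *)
Lemma gaussian_chaos_sqr a c :
  (fun w => (chaos a c \o X) w ^+ 2) \in Lfun P 1 /\
  ('E_P[(fun w => (chaos a c \o X) w ^+ 2)%R] =
    (a ^+ 2 * s ^+ 2 + 2 * c ^+ 2 * s ^+ 4)%:E)%E.
Proof.
(* The coefficients of [chaos a c x ^+ 2], by increasing degree. *)
pose q := nth 0 [:: c ^+ 2 * s ^+ 4; - (2 * a * c * s ^+ 2);
  a ^+ 2 - 2 * c ^+ 2 * s ^+ 2; 2 * a * c; c ^+ 2].
have qE : (fun w => (chaos a c \o X) w ^+ 2) = (fun w => \sum_(i < 5) q i * X w ^+ i).
  by apply/funext => w; rewrite !big_ord_recl big_ord0 /= /q /chaos/=; ring.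
rewrite qE; have [L1 ->] := gaussian_expectation_poly q 5; split=> //.
rewrite !big_ord_recl big_ord0 /= !gaussian_expectation_exprn.
rewrite normal_moment0 normal_moment1// normal_moment2//.
rewrite normal_moment3// normal_moment4// !mule0 mule1 !add0e !adde0.
by rewrite -!EFinM -!EFinD /q /=; congr (_%:E); ring.
Qed.

Lemma gaussian_chaos_Lfun2 a c : (chaos a c \o X) \in Lfun P 2%:E.
Proof.
apply: Lfun2_sqr_integrable; first exact: (measurableT_comp (measurable_chaos a c)).
by have [/Lfun1_integrable] := gaussian_chaos_sqr a c.
Qed.

End gaussian_chaos.

(** * The exact risk *)

Section exact_risk.
Context (R : realType).

Lemma rsum_finite (u : nat -> R) n :
  (forall i, (n < i)%N -> u i = 0) -> rsum u = \sum_(i < n) u i.+1.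
Proof.
move=> u0; apply/cvg_lim => //; apply: cvg_near_cst; near=> k.
have nk : (n < k)%N by near: k; exact: nbhs_infty_gt.
rewrite (@big_cat_nat _ _ _ n.+1)//= [X in _ + X]big_nat_cond [X in _ + X]big1 ?addr0.
  by rewrite big_add1 big_mkord.
by move=> i; rewrite andbT => /andP[ni _]; exact: u0.
Unshelve. all: by end_near. Qed.

Lemma h_eq0 (beta r W : R) i : 0 <= beta -> 0 <= r -> 0 <= W -> W <= i%:R ->
  h beta r W i = 0.
Proof.
move=> b0 r0 W0 Wi; apply/max_idPr.
rewrite subr_le0 ler_pdivlMr ?expR_gt0// mul1r ler_expR.
by rewrite ler_wpM2l ?mulr_ge0// ge0_ler_powR ?nnegrE.
Qed.

Lemma sigma_gt0 (gamma : R) i : (0 < i)%N -> 0 < sigma gamma i.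
Proof. by move=> i0; rewrite powR_gt0// ltr0n. Qed.

Context d (T : measurableType d) (P : probability T R) (xi : nat -> {RV P >-> R}).

Lemma mutual_independence_pair (D : set nat) i j (A B : set R) :
  mutual_independence D xi -> D i -> D j -> i != j ->
  measurable A -> measurable B ->
  P (xi i @^-1` A `&` xi j @^-1` B) = (P (xi i @^-1` A) * P (xi j @^-1` B))%E.
Proof.
move=> indep Di Dj ij mA mB.
pose C k := if k == i then A else B.
have := indep [fset i; j]%fset C.
rewrite big_fsetU1 ?inE//= big_seq_fset1 /C eqxx eq_sym (negbTE ij).
rewrite bigcap_fset big_fsetU1 ?inE//= big_seq_fset1.
rewrite eqxx eq_sym (negbTE ij); apply.
  by move=> k; rewrite !inE => /orP[] /eqP ->.
by move=> k _; case: ifP.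
Qed.

Variable gamma : R.
Hypothesis xi_gaussian : forall (i : nat) (A : set R), (1 <= i)%N -> measurable A ->
  distribution P (xi i) A = normal_prob 0 (sigma gamma i) A.
Hypothesis xi_indep : mutual_independence [set i : nat | (1 <= i)%N] xi.

(** Bias-variance decomposition.  It is valid for every [theta], since [Q theta]
    and the last sum only enter through their values as real numbers. *)
Lemma centered_risk_eq (beta r W e : R) (theta : nat -> R) n :
  (forall i, (n < i)%N -> h beta r W i = 0) ->
  centered_risk xi beta r gamma W e theta =
  ((\sum_(i < n) h beta r W i.+1 * theta i.+1 ^+ 2 - Q theta) ^+ 2 +
   \sum_(i < n) h beta r W i.+1 ^+ 2 *
     (4 * e ^+ 2 * (sigma gamma i.+1 ^+ 2 * theta i.+1 ^+ 2)
      + 2 * e ^+ 4 * sigma gamma i.+1 ^+ 4)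
   - 4 * e ^+ 2 * rsum (fun i => sigma gamma i ^+ 2 * theta i ^+ 2))%:E.
Proof.
move=> h0.
set b := _ - Q theta; set K := 4 * e ^+ 2 * rsum _.
pose H i := h beta r W i.+1; pose s i := sigma gamma i.+1.
pose p i := chaos (s i) (2 * H i * theta i.+1 * e) (H i * e ^+ 2).
pose Z i : T -> R := p i \o xi i.+1.
have s0 i : s i != 0 by rewrite gt_eqF// sigma_gt0.
have XN i A : measurable A -> distribution P (xi i.+1) A = normal_prob 0 (s i) A.
  by move=> mA; exact: xi_gaussian.
have Z2 i : Z i \in Lfun P 2%:E by exact: (gaussian_chaos_Lfun2 (s0 i) (@XN i)).
have EZ i : ('E_P[Z i] = 0)%E by exact: (gaussian_chaos_mean (s0 i) (@XN i)).
have Pfin : P setT \is a fin_num := fin_num_measure P _ measurableT.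
have Z1 i : Z i \in Lfun P 1 by exact: (Lfun_subset12 Pfin (Z2 i)).
have EZZ i j : i != j -> ('E_P[Z i \* Z j] = 0)%E.
  move=> ij; rewrite [LHS](@expectation_mul_indep _ _ _ _ (xi i.+1) (xi j.+1) (p i) (p j)).
  - by rewrite [X in (X * _)%E]EZ mul0e.
  - by move=> A B mA mB; apply: (mutual_independence_pair xi_indep).
  - exact: measurable_chaos.
  - exact: measurable_chaos.
  - exact: Z1.
  - exact: Z1.
  - exact: (Lfun2_mul_Lfun1 (Z2 i) (Z2 j)).
pose v i := (2 * H i * theta i.+1 * e) ^+ 2 * s i ^+ 2 +
   2 * (H i * e ^+ 2) ^+ 2 * s i ^+ 4.
have EZv i : ('E_P[Z i \* Z i] = (v i)%:E)%E.
  have [_ <-] := gaussian_chaos_sqr (s0 i) (@XN i) (2 * H i * theta i.+1 * e) (H i * e ^+ 2).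
  by congr expectation; apply/funext => w; rewrite expr2.
have [SL ES] := expectation_sqr_sum b n Z2 EZ EZZ EZv.
rewrite /centered_risk.
set S := (fun w => b + _) in SL ES.
transitivity ('E_P[((S \* S) \- cst K)%R])%E.
  congr expectation; apply/funext => w /=; congr (_ - _).
  have -> : Qtilde beta r gamma W e (observation xi e theta w) - Q theta = S w.
    rewrite /Qtilde (@rsum_finite _ n); last by move=> i ni; rewrite h0 ?mul0r.
    rewrite /S /b addrAC -big_split/=; congr (_ - _); apply: eq_bigr => i _.
    by rewrite /Z /p /chaos /observation /H /s /=; ring.
  by rewrite expr2.
rewrite expectationB ?Lfun_cst// ES expectation_cst -EFinB.
congr ((_ + _ - _)%:E); apply: eq_bigr => i _; rewrite /v /H /s; ring.
Qed.

End exact_risk.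

(** * A uniform bound of the risk over the ellipsoid *)

Section ellipsoid_bounds.
Context (R : realType).
Implicit Types (beta r gamma L W e : R) (theta : nat -> R).

Lemma rsum_bounds (u : nat -> R) M :
  (forall i, 0 <= u i) -> (forall n, \sum_(i < n) u i.+1 <= M) ->
  (forall n, \sum_(i < n) u i.+1 <= rsum u) /\ rsum u <= M.
Proof.
move=> u0 uM.
pose S n := \sum_(1 <= i < n) u i.
have SE n : S n.+1 = \sum_(i < n) u i.+1 by rewrite /S big_add1 big_mkord.
have S0 : S 0%N = 0 by rewrite /S big_geq.
have ndS : nondecreasing_seq S.
  by apply/nondecreasing_seqP => -[|n]; rewrite ?S0 SE ?sumr_ge0// SE big_ord_recr/= lerDl.
have M0 : 0 <= M by have := uM 0%N; rewrite big_ord0.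
have cS : cvgn S.
  apply: nondecreasing_is_cvgn => //; exists M => _ [[|n] _ <-].
    by rewrite S0.
  by rewrite SE.
split=> [n|].
  by rewrite -SE; exact: (nondecreasing_cvgn_le ndS cS).
by apply: limr_le => //; apply: nearW => -[|n]; rewrite -/(S _) ?S0// SE.
Qed.

Lemma Sigma_partial_sum_le beta r L theta : Sigma beta r L theta ->
  forall n, \sum_(i < n) expR (2 * beta * i.+1%:R `^ r) * theta i.+1 ^+ 2 <= L.
Proof.
move=> thS n; rewrite -lee_fin; apply: le_trans thS.
pose u i := (expR (2 * beta * i%:R `^ r) * theta i ^+ 2)%:E.
have u0 i : (0 <= u i)%E by rewrite lee_fin mulr_ge0 ?expR_ge0 ?sqr_ge0.
apply: le_trans (@nneseries_lim_ge R u xpredT 1 n.+1 (fun i _ _ => u0 i)).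
by rewrite big_add1 big_mkord /u sumEFin.
Qed.

(** This is what makes the series of the [s i ^ 2 * theta i ^ 2] converge on the
    ellipsoid.  With [y = i ^ (r / 2)], the logarithm of the left-hand side is at
    most a multiple of [y], hence at most [2 * beta * y ^ 2] up to a
    constant. *)
Lemma sigma_sqr_le_expR beta r gamma : 0 < beta -> 0 < r -> 0 <= gamma ->
  exists2 C, 0 <= C & forall i, (0 < i)%N ->
    sigma gamma i ^+ 2 <= C * expR (2 * beta * i%:R `^ r).
Proof.
move=> b0 r0 g0; pose a := 4 * gamma / r.
exists (expR (a ^+ 2 / (8 * beta))) => [|i i0]; first exact: expR_ge0.
have i0' : 0 < i%:R :> R by rewrite ltr0n.
pose y := i%:R `^ (r / 2).
have -> : i%:R `^ r = y ^+ 2 by rewrite /y -powR_mulrn ?powR_ge0// -powRrM divfK.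
have -> : sigma gamma i ^+ 2 = expR (2 * gamma * ln i%:R).
  by rewrite /sigma /powR gt_eqF// -expRM_natl mulrA.
rewrite -expRD ler_expR.
have lny : (r / 2) * ln i%:R <= y.
  rewrite /y /powR gt_eqF// (le_trans _ (expR_ge1Dx _))// lerDr//.
have -> : 2 * gamma * ln i%:R = a * ((r / 2) * ln i%:R).
  by rewrite /a; field; rewrite gt_eqF.
have a0 : 0 <= a by rewrite /a divr_ge0 ?mulr_ge0// ltW.
apply: le_trans (ler_wpM2l a0 lny) _.
rewrite -subr_ge0.
have -> : a ^+ 2 / (8 * beta) + 2 * beta * y ^+ 2 - a * y =
    2 * beta * (y - a / (4 * beta)) ^+ 2 by field; rewrite gt_eqF.
by rewrite mulr_ge0 ?sqr_ge0// mulr_ge0// ltW.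
Qed.

Lemma h_ge0 beta r W i : 0 <= h beta r W i.
Proof. by rewrite le_max lexx orbT. Qed.

Lemma h_le1 beta r W i : h beta r W i <= 1.
Proof. by rewrite ge_max ler01 andbT lerBlDr lerDl divr_ge0 ?expR_ge0. Qed.

Lemma one_sub_h_le beta r W i :
  1 - h beta r W i <= expR (2 * beta * i%:R `^ r) / expR (2 * beta * W `^ r).
Proof. by rewrite lerBlDr addrC -lerBlDr le_max lexx. Qed.

(** The weight [1 - h i] is at most [exp (2 beta i ^ r)], the weight defining the
    ellipsoid, divided by [exp (2 beta W ^ r)].  The bound on [Q theta] is
    obtained on partial sums, as [Q theta] is a limit. *)
Lemma bias_le beta r W L theta n : 0 < beta -> 0 < r ->
  (forall i, (n < i)%N -> h beta r W i = 0) -> Sigma beta r L theta ->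
  (\sum_(i < n) h beta r W i.+1 * theta i.+1 ^+ 2 - Q theta) ^+ 2 <=
    L ^+ 2 * expR (- (4 * beta * W `^ r)).
Proof.
move=> b0 r0 h0 /Sigma_partial_sum_le thL.
have th1 m : \sum_(i < m) theta i.+1 ^+ 2 <= L.
  apply: le_trans (thL m); apply: ler_sum => i _.
  rewrite ler_peMl ?sqr_ge0// -expR0 ler_expR mulr_ge0 ?powR_ge0//.
  by rewrite mulr_ge0// ltW.
pose D := L * expR (- (2 * beta * W `^ r)).
have th2 m : \sum_(i < m) (1 - h beta r W i.+1) * theta i.+1 ^+ 2 <= D.
  rewrite /D mulrC; apply: le_trans (ler_wpM2l (expR_ge0 _) (thL m)).
  rewrite mulr_sumr; apply: ler_sum => i _; rewrite [leRHS]mulrA ler_wpM2r ?sqr_ge0//.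
  by rewrite mulrC expRN one_sub_h_le.
set H := \sum_(i < n) _.
have HE : rsum (fun i => h beta r W i * theta i ^+ 2) = H.
  by apply: rsum_finite => i ni; rewrite h0 ?mul0r.
have th3 m : \sum_(i < m) h beta r W i.+1 * theta i.+1 ^+ 2 <= L.
  apply: le_trans (th1 m); apply: ler_sum => i _.
  by rewrite ler_piMl ?sqr_ge0 ?h_le1.
have [Hp _] := @rsum_bounds (fun i => h beta r W i * theta i ^+ 2) L
  (fun i => mulr_ge0 (h_ge0 _ _ _ _) (sqr_ge0 _)) th3.
have [Qp _] := @rsum_bounds (fun i => theta i ^+ 2) L (fun i => sqr_ge0 _) th1.
have thHD m : \sum_(i < m) theta i.+1 ^+ 2 <= H + D.
  rewrite -HE; apply: le_trans (lerD (Hp m) (th2 m)).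
  by rewrite -big_split/=; apply: ler_sum => i _; rewrite -mulrDl subrKC mul1r.
have [_ QD] := @rsum_bounds (fun i => theta i ^+ 2) (H + D) (fun i => sqr_ge0 _) thHD.
have HQ : H <= Q theta.
  apply: le_trans (Qp n); apply: ler_sum => i _.
  by rewrite ler_piMl ?sqr_ge0 ?h_le1.
have -> : L ^+ 2 * expR (- (4 * beta * W `^ r)) = D ^+ 2.
  by rewrite /D exprMn -expRM_natl; congr (_ * expR _); ring.
rewrite -sqrrN opprB lerXn2r ?nnegrE ?subr_ge0//.
  by rewrite (le_trans _ (th2 0%N))// big_ord0.
by rewrite lerBlDl.
Qed.

(** The risk at the null signal is [2 * e ^ 4] times this sum; the exponent comes
    from [sigma gamma i ^+ 4]. *)
Definition noise beta r gamma W n : R :=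
  \sum_(i < n) h beta r W i.+1 ^+ 2 * i.+1%:R `^ (4 * gamma).

Lemma sigma4 gamma i : sigma gamma i ^+ 4 = i%:R `^ (4 * gamma).
Proof. by rewrite /sigma -powR_mulrn ?powR_ge0// -powRrM mulrC. Qed.

(** The part [4 * e ^ 2 * sum h i ^ 2 * s i ^ 2 * theta i ^ 2] of the variance
    is compensated by the centering, as [h i <= 1]. *)
Lemma risk_le beta r gamma W L e theta n : 0 < beta -> 0 < r -> 0 <= gamma ->
  (forall i, (n < i)%N -> h beta r W i = 0) -> Sigma beta r L theta ->
  (\sum_(i < n) h beta r W i.+1 * theta i.+1 ^+ 2 - Q theta) ^+ 2 +
   \sum_(i < n) h beta r W i.+1 ^+ 2 *
     (4 * e ^+ 2 * (sigma gamma i.+1 ^+ 2 * theta i.+1 ^+ 2)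
      + 2 * e ^+ 4 * sigma gamma i.+1 ^+ 4)
   - 4 * e ^+ 2 * rsum (fun i => sigma gamma i ^+ 2 * theta i ^+ 2) <=
  L ^+ 2 * expR (- (4 * beta * W `^ r)) + 2 * e ^+ 4 * noise beta r gamma W n.
Proof.
move=> b0 r0 g0 h0 thS; rewrite -addrA lerD//; first exact: bias_le.
have [C C0 sC] := sigma_sqr_le_expR b0 r0 g0.
have sL m : \sum_(i < m) sigma gamma i.+1 ^+ 2 * theta i.+1 ^+ 2 <= C * L.
  apply: le_trans (ler_wpM2l C0 (Sigma_partial_sum_le thS m)).
  rewrite mulr_sumr; apply: ler_sum => i _; rewrite [leRHS]mulrA.
  by rewrite ler_wpM2r ?sqr_ge0// sC.
have [Sp _] := @rsum_bounds (fun i => sigma gamma i ^+ 2 * theta i ^+ 2) (C * L)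
  (fun i => mulr_ge0 (sqr_ge0 _) (sqr_ge0 _)) sL.
have e2 : 0 <= 4 * e ^+ 2 by rewrite mulr_ge0 ?sqr_ge0.
rewrite lerBlDr; apply: le_trans (lerD (lexx _) (ler_wpM2l e2 (Sp n))).
rewrite /noise !mulr_sumr -big_split/=; apply: ler_sum => i _.
rewrite mulrDr [leLHS]addrC sigma4 lerD//; first by rewrite mulrCA.
rewrite ler_piMl//; first by rewrite mulr_ge0// mulr_ge0 ?sqr_ge0.
by rewrite exprn_ile1 ?h_ge0 ?h_le1.
Qed.

End ellipsoid_bounds.

(** * Powers, logarithms and power sums at infinity *)

Section limits_at_infinity.
Context (R : realType) (T : Type) (F : set_system T) (FF : Filter F).
Implicit Types (f : T -> R) (s : R).

Lemma cvg_powRy f s : 0 < s -> f x @[x --> F] --> +oo ->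
  f x `^ s @[x --> F] --> +oo.
Proof.
move=> s0 foo; apply/cvgryPge => A; pose B := Num.max A 1.
have B1 : 1 <= B by rewrite le_max lexx orbT.
have B0 : 0 <= B by rewrite (le_trans _ B1).
near=> x.
have fx : B `^ s^-1 <= f x by near: x; move/cvgryPge: foo; apply.
apply: (@le_trans _ _ B); first by rewrite le_max lexx.
rewrite -[leLHS]powRr1// -(mulVf (lt0r_neq0 s0)) powRrM.
by rewrite ge0_ler_powR ?nnegrE ?powR_ge0 ?(ltW s0)// (le_trans _ fx) ?powR_ge0.
Unshelve. all: by end_near. Qed.

Lemma cvgyV f : f x @[x --> F] --> +oo -> (f x)^-1 @[x --> F] --> 0.
Proof.
move=> foo; apply/cvgrPdist_le => e e0; near=> x.
have fx : e^-1 <= f x by near: x; move/cvgryPge: foo; apply.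
have f0 : 0 < f x by rewrite (lt_le_trans _ fx) ?invr_gt0.
rewrite sub0r normrN ger0_norm ?invr_ge0 ?(ltW f0)//.
by rewrite -[leRHS]invrK lef_pV2 ?posrE ?invr_gt0.
Unshelve. all: by end_near. Qed.

Lemma cvg_powRNy f s : 0 < s -> f x @[x --> F] --> +oo ->
  f x `^ (- s) @[x --> F] --> 0.
Proof.
move=> s0 foo; under eq_fun do rewrite powRN.
exact/cvgyV/cvg_powRy.
Qed.

Lemma cvg_powR1 f s : f x @[x --> F] --> (1 : R) -> f x `^ s @[x --> F] --> (1 : R).
Proof.
move=> f1; rewrite -[X in _ --> X](_ : 1 `^ s = 1); last by rewrite powR1.
apply: (cvg_comp f (fun y => y `^ s) f1).
have d1 : is_derive (1 : R) 1 (fun x : R => x `^ s) (s * 1 `^ (s - 1)).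
  exact: is_derive1_powR.
have c1 : {for (1 : R), continuous (fun y : R => y `^ s)}.
  by apply/differentiable_continuous/derivable1_diffP; case: d1.
exact: c1.
Qed.

Lemma cvg_expRNy f : f x @[x --> F] --> +oo -> expR (- f x) @[x --> F] --> (0 : R).
Proof. by move=> foo; apply: (cvg_comp f (fun y => expR (- y)) foo); exact: cvgr_expR. Qed.

Lemma cvg_gt0_mulry f k : 0 < k -> f x @[x --> F] --> +oo -> k * f x @[x --> F] --> +oo.
Proof.
move=> k0 foo; apply/cvgryPge => A; near=> x.
rewrite -ler_pdivrMl// mulrC; near: x; move/cvgryPge: foo; exact.
Unshelve. all: by end_near. Qed.

(** [(s / 2) * ln x = ln (x ^ (s / 2)) <= x ^ (s / 2)], which leaves a factor
    [x ^ (- s / 2)] to spare. *)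
Lemma cvg_lnMpowRNy f s : 0 < s -> f x @[x --> F] --> +oo ->
  ln (f x) * f x `^ (- s) @[x --> F] --> 0.
Proof.
move=> s0 foo.
have s20 : 0 < s / 2 by rewrite divr_gt0.
have H : (s / 2)^-1 * f x `^ (- (s / 2)) @[x --> F] --> 0.
  rewrite -[X in _ --> X](mulr0 (s / 2)^-1); apply: cvgMl_tmp.
  exact: cvg_powRNy.
apply: (squeeze_cvgr _ (cvg_cst 0) H); near=> x.
have f1 : 1 <= f x by near: x; move/cvgryPge: foo; exact.
have f0 : 0 < f x by exact: lt_le_trans f1.
rewrite mulr_ge0 ?powR_ge0 ?ln_ge0//=.
have lny : (s / 2) * ln (f x) <= f x `^ (s / 2).
  by rewrite /powR gt_eqF// (le_trans _ (expR_ge1Dx _))// lerDr.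
rewrite -ler_pdivlMl in lny => //.
apply: le_trans (ler_wpM2r (powR_ge0 _ _) lny) _.
rewrite -mulrA -powRD; last by rewrite (gt_eqF f0) implybT.
by have -> : s / 2 - s = - (s / 2) by field.
Unshelve. all: by end_near. Qed.

End limits_at_infinity.

Section power_sums.
Context (R : realType).
Implicit Types (p x : R).

(** The mean value theorem for [y ^ (p + 1)] on [[x, x + 1]]; the case [x = 0]
    is apart because [y ^ (p + 1)] has no two-sided derivative there in
    general. *)
Lemma powR_increment_bounds p x : 0 <= p -> 0 <= x ->
  (p + 1) * x `^ p <= (x + 1) `^ (p + 1) - x `^ (p + 1) <=
  (p + 1) * (x + 1) `^ p.
Proof.
move=> p0; rewrite le_eqVlt => /predU1P[<-|x0].
  have p1 : p + 1 != 0 by rewrite gt_eqF// ltr_wpDl.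
  rewrite add0r !powR1 (powR0 p1) subr0 mulr1 lerDr p0 andbT.
  have [->|pn0] := eqVneq p 0; first by rewrite powRr0 add0r mul1r.
  by rewrite powR0// mulr0.
have x1 : x < x + 1 by rewrite ltrDl.
have [||c] := @MVT R (fun y => y `^ (p + 1)) (fun y => (p + 1) * y `^ (p + 1 - 1)) _ _ x1.
- move=> y; rewrite in_itv/= => /andP[xy _]; apply: is_derive1_powR.
  exact: lt_trans xy.
- apply: derivable_within_continuous => y; rewrite in_itv/= => /andP[xy _].
  have [] := @is_derive1_powR R (p + 1) y; last by [].
  exact: lt_le_trans xy.
rewrite in_itv/= => /andP[xc cx] ->; rewrite addrK [x + 1 - x]addrAC subrr add0r mulr1.
have c0 : 0 < c by exact: lt_trans xc.
have p10 : 0 <= p + 1 by rewrite addr_ge0.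
have c1 := lt_trans c0 cx.
by apply/andP; split; rewrite ler_wpM2l// ge0_ler_powR ?nnegrE ?(ltW x0) ?(ltW c0) ?(ltW c1) ?(ltW xc) ?(ltW cx).
Qed.

Lemma sum_powR_ge p n : 0 <= p ->
  n%:R `^ (p + 1) <= (p + 1) * \sum_(i < n) i.+1%:R `^ p.
Proof.
move=> p0; elim: n => [|n IH].
  by rewrite big_ord0 mulr0 powR0// gt_eqF// ltr_wpDl.
have /andP[_] := powR_increment_bounds p0 (ler0n R n).
rewrite natr1 big_ord_recr/= mulrDr => H.
by rewrite -lerBlDl (le_trans _ H)// lerD2l lerN2.
Qed.

Lemma sum_powR_le p n : 0 <= p ->
  (p + 1) * \sum_(i < n) i.+1%:R `^ p <= n.+1%:R `^ (p + 1).
Proof.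
move=> p0; elim: n => [|n IH]; first by rewrite big_ord0 mulr0 powR_ge0.
have /andP[H _] := powR_increment_bounds p0 (ler0n R n.+1).
rewrite natr1 in H.
by rewrite big_ord_recr/= mulrDr -lerBrDl (le_trans H)// lerD2l lerN2.
Qed.

End power_sums.

(** * The risk at the null signal *)

Section noise_asymptotics.
Context (R : realType) (beta r gamma : R).
Hypotheses (beta_gt0 : 0 < beta) (r_gt0 : 0 < r) (gamma_ge0 : 0 <= gamma).

Let a := 4 * gamma + 1.

Let p0 : 0 <= 4 * gamma. Proof. by rewrite mulr_ge0. Qed.

Lemma noise_le W : 0 <= W ->
  a * noise beta r gamma W (Num.truncn W) <= (W + 1) `^ a.
Proof.
move=> W0; set n := Num.truncn W.
have a0 : 0 <= a by rewrite addr_ge0.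
apply: (@le_trans _ _ (a * \sum_(i < n) i.+1%:R `^ (4 * gamma))).
  rewrite ler_wpM2l// ler_sum// => i _.
  by rewrite ler_piMl ?powR_ge0// exprn_ile1 ?h_ge0 ?h_le1.
apply: le_trans (sum_powR_le n p0) _.
by rewrite ge0_ler_powR ?nnegrE ?addr_ge0// -natr1 lerD2r truncn_le.
Qed.

(* Chosen so that [v W ^ r = W ^ r - W ^ (r / 2)]: up to [v W] the weights are
   uniformly close to [1], yet [v W] is equivalent to [W]. *)
Let v W := W * (1 - W `^ (- (r / 2))) `^ r^-1.

(** Keep only the indices up to [v W], where
    [1 - h i <= exp (2 beta (v W ^ r - W ^ r)) = exp (- 2 beta W ^ (r / 2))]. *)
Lemma noise_ge W : 1 <= W -> 1 <= v W ->
  (1 - expR (- (2 * beta * W `^ (r / 2)))) ^+ 2 * (v W - 1) `^ a <=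
  a * noise beta r gamma W (Num.truncn W).
Proof.
move=> W1 v1.
have W0 : 0 < W by rewrite (lt_le_trans _ W1).
have a0 : 0 <= a by rewrite addr_ge0.
have v0 : 0 <= v W by rewrite (le_trans _ v1).
have x0 : 0 <= 1 - W `^ (- (r / 2)).
  rewrite subr_ge0 -[leRHS](powRr0 W) ler_powR// lerNl oppr0 divr_ge0//.
  exact: ltW.
have vr : v W `^ r = W `^ r - W `^ (r / 2).
  rewrite /v powRM ?powR_ge0 ?(ltW W0)// -powRrM mulVf ?gt_eqF// powRr1//.
  rewrite mulrBr mulr1 -powRD; last by rewrite (gt_eqF W0) implybT.
  by have -> : r - r / 2 = r / 2 by field.
have vW : v W <= W.
  rewrite -[leRHS]mulr1 ler_wpM2l ?(ltW W0)//.
  have : (1 - W `^ (- (r / 2))) `^ r^-1 <= 1 `^ r^-1.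
    rewrite ge0_ler_powR ?nnegrE ?invr_ge0 ?(ltW r_gt0)//.
    by rewrite lerBlDr lerDl powR_ge0.
  by rewrite powR1.
set n := Num.truncn W; set m := Num.truncn (v W).
have mn : (m <= n)%N by exact: le_truncn.
set K := 1 - expR _.
have K0 : 0 <= K.
  rewrite subr_ge0 -[leRHS]expR0 ler_expR oppr_le0.
  by rewrite mulr_ge0 ?powR_ge0// mulr_ge0// ltW.
have hK i : (i < m)%N -> K <= h beta r W i.+1.
  move=> im; rewrite /K lerBlDr addrC -lerBlDr.
  apply: le_trans (one_sub_h_le _ _ _ _) _.
  rewrite -expRN -expRD ler_expR -!mulrN -mulrDr ler_wpM2l//.
    by rewrite mulr_ge0// ltW.
  rewrite lerBlDr addrC -vr.
  rewrite ge0_ler_powR ?nnegrE ?(ltW r_gt0)//.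
  by rewrite -truncn_ge_nat.
apply: (@le_trans _ _ (a * \sum_(i < m) K ^+ 2 * i.+1%:R `^ (4 * gamma))).
  rewrite -mulr_sumr mulrCA ler_wpM2l ?sqr_ge0//.
  apply: le_trans (sum_powR_ge m p0).
  rewrite ge0_ler_powR ?nnegrE ?subr_ge0//.
  by rewrite lerBlDr natr1 ltW// truncnS_gt.
rewrite ler_wpM2l// /noise.
rewrite (big_ord_widen n (fun i => K ^+ 2 * i.+1%:R `^ (4 * gamma)) mn) big_mkcond.
apply: ler_sum => i _; case: ifP => [im|_].
  by rewrite ler_wpM2r ?powR_ge0// lerXn2r ?nnegrE ?h_ge0 ?hK.
by rewrite mulr_ge0 ?sqr_ge0 ?powR_ge0.
Qed.

Lemma noise_equiv (T : Type) (F : set_system T) (FF : Filter F) (f : T -> R) :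
  f x @[x --> F] --> +oo ->
  a * noise beta r gamma (f x) (Num.truncn (f x)) / f x `^ a @[x --> F] --> (1 : R).
Proof.
move=> foo.
have a0 : 0 <= a by rewrite addr_ge0.
have r20 : 0 < r / 2 by rewrite divr_gt0.
have fV := cvgyV FF foo.
have vf : (1 - f x `^ (- (r / 2))) `^ r^-1 @[x --> F] --> (1 : R).
  apply: cvg_powR1; rewrite -[X in _ --> X]subr0; apply: cvgB; first exact: cvg_cst.
  exact: cvg_powRNy.
have voo : v (f x) @[x --> F] --> +oo.
  apply/cvgryPge => A.
  have : \forall x \near F, 2^-1 <= (1 - f x `^ (- (r / 2))) `^ r^-1.
    move/cvgrPdist_le : vf => /(_ 2^-1); rewrite invr_gt0 ltr0n => /(_ isT).
    by apply: filterS => x; rewrite ler_distl => /andP[_]; lra.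
  move=> half; near=> x.
  have f1 : 2 * Num.max A 0 <= f x by near: x; move/cvgryPge: foo; exact.
  have h1 : 2^-1 <= (1 - f x `^ (- (r / 2))) `^ r^-1 by near: x.
  have M0 : 0 <= Num.max A 0 by rewrite le_max lexx orbT.
  have MA : A <= Num.max A 0 by rewrite le_max lexx.
  have : 2 * Num.max A 0 * 2^-1 <= v (f x) by rewrite ler_pM// mulr_ge0.
  by rewrite mulrAC divff// mul1r; exact: le_trans.
have up : (1 + (f x)^-1) `^ a @[x --> F] --> (1 : R).
  apply: cvg_powR1; rewrite -[X in _ --> X]addr0; apply: cvgD => //; exact: cvg_cst.
have low : (1 - expR (- (2 * beta * f x `^ (r / 2)))) ^+ 2 *
    ((1 - f x `^ (- (r / 2))) `^ r^-1 - (f x)^-1) `^ a @[x --> F] --> (1 : R).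
  rewrite -[X in _ --> X](mul1r 1); apply: cvgM.
    have k1 : 1 - expR (- (2 * beta * f x `^ (r / 2))) @[x --> F] --> (1 : R).
      rewrite -[X in _ --> X]subr0; apply: cvgB; first exact: cvg_cst.
      apply: cvg_expRNy; apply: cvg_gt0_mulry; first by rewrite mulr_gt0.
      exact: cvg_powRy.
    by rewrite -[X in _ --> X](mul1r 1); exact: (cvgM k1 k1).
  apply: cvg_powR1; rewrite -[X in _ --> X]subr0; exact: cvgB.
apply: (squeeze_cvgr _ low up); near=> x.
have f1 : 1 <= f x by near: x; move/cvgryPge: foo; exact.
have v1 : 1 <= v (f x) by near: x; move/cvgryPge: voo; exact.
have f0 : 0 < f x by exact: lt_le_trans f1.
have fa0 : 0 < f x `^ a by rewrite powR_gt0.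
apply/andP; split.
  have w0 : 0 <= (1 - f x `^ (- (r / 2))) `^ r^-1 - (f x)^-1.
    by rewrite -(ler_pM2r f0) mul0r mulrBl mulVf ?gt_eqF// mulrC subr_ge0.
  rewrite ler_pdivlMr// -[leLHS]mulrA -powRM ?(ltW f0)//.
  rewrite mulrBl mulVf ?gt_eqF//.
  apply: le_trans (noise_ge f1 v1); rewrite /v.
  by rewrite [(1 - _) `^ r^-1 * _]mulrC.
rewrite ler_pdivrMr// -powRM ?addr_ge0 ?invr_ge0 ?(ltW f0)//.
by rewrite [(1 + _) * f x]mulrDl mul1r mulVf ?gt_eqF// noise_le ?(ltW f0).
Unshelve. all: by end_near. Qed.

End noise_asymptotics.

(** * The bandwidth *)

Section bandwidth.
Context (R : realType) (beta r gamma L : R).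
Hypotheses (beta_gt0 : 0 < beta) (r_gt0 : 0 < r) (gamma_ge0 : 0 <= gamma)
  (L_gt0 : 0 < L).
Variable W : R -> R.
Hypothesis W_sol : \forall e \near 0^'+,
  0 < W e /\ W_equation beta r gamma L e (W e).

Let a := 4 * gamma + 1.
Let q := Num.max (1 - r) 0.
Let c := cst_W beta r L.
Let I : R := if 1 < r then 1 else 0.

Let I0 : 0 <= I. Proof. by rewrite /I; case: ifP. Qed.

Let p0 : 0 <= 4 * gamma. Proof. by rewrite mulr_ge0. Qed.

Let q0 : 0 <= q. Proof. by rewrite le_max lexx orbT. Qed.

Let q1 : q < 1. Proof. by rewrite gt_max ltrBlDr ltrDl r_gt0 ltr01. Qed.

Lemma cst_W_gt0 : 0 < c.
Proof.
have L2 : 0 < L ^+ 2 by rewrite exprn_gt0.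
rewrite /c /cst_W; case: ifP => _; first by rewrite !mulr_gt0.
case: ifP => _; last by case: ifP => _; rewrite divr_gt0// mulr_gt0 ?expR_gt0.
rewrite divr_gt0// mulr_gt0 ?expR_gt0// subr_gt0 -expR0 ltr_expR.
by rewrite mulr_gt0.
Qed.

(** The left-hand side of the equation for [W] is bounded on bounded sets of
    [W], whereas its right-hand side is unbounded. *)
Lemma bandwidth_cvgy : W e @[e --> 0^'+] --> +oo.
Proof.
have c0 := cst_W_gt0.
apply/cvgryPge => A; pose M := Num.max A 1.
have M0 : 0 < M by rewrite lt_max ltr01 orbT.
pose K := M `^ (4 * gamma + q) * expR (4 * beta * M `^ r).
have K0 : 0 < K by rewrite mulr_gt0 ?expR_gt0 ?powR_gt0.
near=> e.
have e0 : 0 < e by near: e; exact: nbhs_right_gt.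
have e1 : e < 1 by near: e; exact: nbhs_right_lt.
have eK : e < c / K by near: e; apply: nbhs_right_lt; rewrite divr_gt0.
have [We0 Weq] : 0 < W e /\ W_equation beta r gamma L e (W e) by near: e.
apply: (@le_trans _ _ M); first by rewrite le_max lexx.
rewrite leNgt; apply/negP => WM.
suff : K < K by rewrite ltxx.
apply: (@lt_le_trans _ _ (c * e ^- 4)).
  rewrite ltr_pdivlMr ?exprn_gt0// mulrC -ltr_pdivlMr//; apply: le_lt_trans eK.
  by rewrite exprS ler_piMr ?(ltW e0)// exprn_ile1 ?(ltW e0) ?(ltW e1).
rewrite -Weq /K ler_pM ?powR_ge0 ?expR_ge0//.
  by rewrite ge0_ler_powR ?nnegrE ?addr_ge0 ?(ltW We0) ?(ltW M0) ?(ltW WM).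
rewrite ler_expR lerBlDr; apply: (@le_trans _ _ (4 * beta * M `^ r)).
  rewrite ler_wpM2l ?mulr_ge0 ?(ltW beta_gt0)//.
  by rewrite ge0_ler_powR ?nnegrE ?(ltW r_gt0) ?(ltW We0) ?(ltW M0) ?(ltW WM).
by rewrite lerDl !mulr_ge0 ?powR_ge0 ?(ltW r_gt0) ?(ltW beta_gt0).
Unshelve. all: by end_near. Qed.

(** Take logarithms in the equation for [W] and divide by [4 beta W ^ r]: every
    term other than [1] and [ln (1 / e) / (beta W ^ r)] is [O(1 / W)] or
    [O((1 + ln W) / W ^ r)]. *)
Lemma bandwidth_equiv : (ln e^-1 / beta) / W e `^ r @[e --> 0^'+] --> (1 : R).
Proof.
have c0 := cst_W_gt0; have Woo := bandwidth_cvgy.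
pose g e := 1 - r / 2 * I * (W e)^-1
  + (4 * gamma + q) / (4 * beta) * (ln (W e) * W e `^ (- r))
  - ln c / (4 * beta) * W e `^ (- r).
have : g e @[e --> 0^'+] --> 1 - r / 2 * I * 0 + (4 * gamma + q) / (4 * beta) * 0
    - ln c / (4 * beta) * 0.
  apply: cvgB; [apply: cvgD; [apply: cvgB; [exact: cvg_cst|]|]|]; apply: cvgMl_tmp.
  - exact: cvgyV.
  - exact: cvg_lnMpowRNy.
  - exact: cvg_powRNy.
rewrite !mulr0 !(subr0, addr0); apply: cvg_trans; apply: near_eq_cvg; near=> e.
have e0 : 0 < e by near: e; exact: nbhs_right_gt.
have [We0 Weq] : 0 < W e /\ W_equation beta r gamma L e (W e) by near: e.
have Wr0 : 0 < W e `^ r by rewrite powR_gt0.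
have := congr1 (@ln R) Weq.
rewrite lnM ?posrE ?powR_gt0 ?expR_gt0// ln_powR expRK.
rewrite lnM ?posrE ?invr_gt0 ?exprn_gt0//.
have -> : e ^- 4 = e^-1 ^+ 4 by rewrite exprVn.
rewrite lnXn ?invr_gt0// -/c -/q -/I => H.
have Wr1 : W e `^ (r - 1) = W e `^ r / W e.
  by rewrite powRB ?powRr1 ?(ltW We0)// (gt_eqF We0) implybT.
rewrite /g powRN.
have lE : ln e^-1 = ((4 * gamma + q) * ln (W e) + (4 * beta * W e `^ r -
   2 * beta * r * (W e `^ r / W e) * I) - ln c) / 4.
  by rewrite -Wr1 H -mulr_natr; field.
rewrite lE; field.
by rewrite !gt_eqF.
Unshelve. all: by end_near. Qed.

(** Replacing [e ^ (- 4)] by its value cancels the exponential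
    [exp (- 4 beta W ^ r)] and leaves at most a constant times
    [W ^ (max (1 - r) 0 - 1)], whose exponent is negative. *)
Lemma bias_negligible :
  L ^+ 2 * expR (- (4 * beta * W e `^ r)) / (e ^+ 4 * W e `^ a) @[e --> 0^'+] --> (0 : R).
Proof.
have c0 := cst_W_gt0; have Woo := bandwidth_cvgy.
have H : L ^+ 2 / c * W e `^ (- (1 - q)) @[e --> 0^'+] --> 0.
  rewrite -[X in _ --> X](mulr0 (L ^+ 2 / c)); apply: cvgMl_tmp.
  by apply: cvg_powRNy; rewrite // subr_gt0.
apply: (squeeze_cvgr _ (cvg_cst 0) H); near=> e.
have e0 : 0 < e by near: e; exact: nbhs_right_gt.
have [We0 Weq] : 0 < W e /\ W_equation beta r gamma L e (W e) by near: e.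
have Wa0 : 0 < W e `^ a by rewrite powR_gt0.
apply/andP; split.
  by rewrite divr_ge0// mulr_ge0 ?sqr_ge0 ?expR_ge0 ?powR_ge0 ?exprn_ge0 ?(ltW e0).
have E4 : e ^- 4 = W e `^ (4 * gamma + q) * expR (4 * beta * W e `^ r
          - 2 * beta * r * W e `^ (r - 1) * I) / c.
  by rewrite Weq mulrAC divff ?mul1r// gt_eqF.
rewrite invfM E4 expRD.
have -> : W e `^ (- (1 - q)) = W e `^ (4 * gamma + q) / W e `^ a.
  rewrite -powRB; last by rewrite (gt_eqF We0) implybT.
  by congr (_ `^ _); rewrite /a; ring.
have EE : expR (- (4 * beta * W e `^ r)) * expR (4 * beta * W e `^ r) = 1.
  by rewrite -expRD addNr expR0.
set x := expR (- (2 * beta * r * _ * I)).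
have x1 : x <= 1.
  rewrite /x -[leRHS]expR0 ler_expR oppr_le0.
  by rewrite !mulr_ge0 ?powR_ge0 ?(ltW r_gt0) ?(ltW beta_gt0).
rewrite [leLHS](_ : _ = (L ^+ 2 / c * (W e `^ (4 * gamma + q) / W e `^ a)) * x *
   (expR (- (4 * beta * W e `^ r)) * expR (4 * beta * W e `^ r))).
  rewrite EE mulr1 ler_piMr//.
  by rewrite mulr_ge0 ?divr_ge0 ?powR_ge0 ?sqr_ge0 ?(ltW c0).
by field; rewrite !gt_eqF.
Unshelve. all: by end_near. Qed.

End bandwidth.

(** * The supremum of the risk *)

Section supremum_of_risk.
Context (R : realType) (d : measure_display) (T : measurableType d)
  (P : probability T R) (xi : nat -> {RV P >-> R}) (gamma : R).
Hypothesis xi_gaussian : forall (i : nat) (A : set R), (1 <= i)%N -> measurable A ->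
  distribution P (xi i) A = normal_prob 0 (sigma gamma i) A.
Hypothesis xi_indep : mutual_independence [set i : nat | (1 <= i)%N] xi.

(** The lower bound is the risk at the null signal. *)
Lemma sup_centered_risk_bounds (beta r L W e : R) :
  0 < beta -> 0 < r -> 0 <= gamma -> 0 < L -> 0 < W ->
  let V := 2 * e ^+ 4 * noise beta r gamma W (Num.truncn W) in
  let s := ereal_sup [set centered_risk xi beta r gamma W e theta
                | theta in Sigma beta r L] in
  (V%:E <= s /\
   s <= (L ^+ 2 * expR (- (4 * beta * W `^ r)) + V)%:E)%E.
Proof.
move=> b0 r0 g0 L0 W0 V s.
have h0 i : (Num.truncn W < i)%N -> h beta r W i = 0.
  move=> Wi; apply: h_eq0; rewrite ?(ltW b0) ?(ltW r0) ?(ltW W0)//.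
  by rewrite (le_trans (ltW (truncnS_gt W)))// ler_nat.
have riskE theta := centered_risk_eq xi_gaussian xi_indep e theta h0.
split.
  apply: le_ereal_sup_tmp; exists V%:E => //.
  exists (fun=> 0).
    rewrite /Sigma/= eseries0 ?lee_fin ?(ltW L0)// => i _ _.
    by rewrite expr0n mulr0.
  rewrite riskE; congr (_%:E).
  have rs0 (u : nat -> R) : (forall i, u i = 0) -> rsum u = 0.
    by move=> u0; rewrite (@rsum_finite _ u 0%N) ?big_ord0.
  rewrite /Q !rs0; do ?[by move=> i; rewrite /= expr0n ?mulr0].
  rewrite big1 => [|i _]; last by rewrite /= expr0n mulr0.
  rewrite subr0 expr0n add0r mulr0 subr0 /V /noise mulr_sumr.
  by apply: eq_bigr => i _; rewrite /= sigma4 !mulr0 add0r mulrCA.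
apply: ge_ereal_sup => _ [theta thS <-].
by rewrite riskE lee_fin; exact: risk_le.
Qed.

End supremum_of_risk.

Unset Implicit Arguments.

Theorem theorem2 (R : realType) (beta r gamma L : R)
  (beta_gt0 : 0 < beta) (r_gt0 : 0 < r) (r_le2 : r <= 2)
  (gamma_ge0 : 0 <= gamma) (L_gt0 : 0 < L)
  (d : measure_display) (T : measurableType d) (P : probability T R)
  (xi : nat -> {RV P >-> R})
  (xi_gaussian : forall (i : nat) (A : set R), (1 <= i)%N -> measurable A ->
     distribution P (xi i) A = normal_prob 0 (sigma gamma i) A)
  (xi_indep : mutual_independence [set i : nat | (1 <= i)%N] xi)
  (W : R -> R)
  (W_sol : \forall e \near 0^'+,
     0 < W e /\ W_equation beta r gamma L e (W e)) :
  exists2 o : R -> R, o e @[e --> 0^'+] --> 0 &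
    \forall e \near 0^'+,
      ereal_sup [set centered_risk xi beta r gamma (W e) e theta
                | theta in Sigma beta r L] =
      (2 * e ^+ 4 / (4 * gamma + 1)
       * (ln (e^-1) / beta) `^ ((4 * gamma + 1) / r) * (1 + o e))%:E.
Proof.
pose a := 4 * gamma + 1.
have a0 : 0 < a by rewrite ltr_wpDl// mulr_ge0.
pose s e := ereal_sup [set centered_risk xi beta r gamma (W e) e theta
                | theta in Sigma beta r L].
pose l e := ln e^-1 / beta.
pose D e := 2 * e ^+ 4 / a * l e `^ (a / r).
pose V e := 2 * e ^+ 4 * noise beta r gamma (W e) (Num.truncn (W e)).
pose B e := L ^+ 2 * expR (- (4 * beta * W e `^ r)).
have FF : Filter (0 : R)^'+ by exact: at_right_proper_filter.
have Woo := bandwidth_cvgy beta_gt0 r_gt0 gamma_ge0 L_gt0 W_sol.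
have small : \forall e \near 0^'+, [/\ 0 < e, e < 1, 0 < W e, 0 < l e & 0 < D e].
  near=> e.
  have e0 : 0 < e by near: e; exact: nbhs_right_gt.
  have e1 : e < 1 by near: e; exact: nbhs_right_lt.
  have [We0 _] : 0 < W e /\ W_equation beta r gamma L e (W e) by near: e.
  have l0 : 0 < l e by rewrite divr_gt0// ln_gt0// invf_gt1.
  by split=> //; rewrite mulr_gt0 ?powR_gt0// divr_gt0// mulr_gt0// exprn_gt0.
have sVB : \forall e \near 0^'+,
    [/\ s e \is a fin_num, V e <= fine (s e) & fine (s e) <= B e + V e].
  apply: filterS small => e [_ _ We0 _ _].
  have [Vs sB] : ((V e)%:E <= s e /\ s e <= (B e + V e)%:E)%E.
    exact: (sup_centered_risk_bounds xi_gaussian xi_indep).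
  have fs : s e \is a fin_num.
    by rewrite fin_numE -ltNye (lt_le_trans _ Vs) ?ltNyr// -ltey (le_lt_trans sB) ?ltry.
  by split=> //; rewrite -lee_fin fineK.
(* [W ^ r ~ l] raised to the power [a / r]. *)
have Wl : W e `^ a / l e `^ (a / r) @[e --> 0^'+] --> (1 : R).
  have := cvg_powR1 (- (a / r)) (bandwidth_equiv beta_gt0 r_gt0 gamma_ge0 L_gt0 W_sol).
  apply: cvg_trans; apply: near_eq_cvg; apply: filterS small => e [e0 e1 We0 l0 _].
  rewrite -/(l e) powRN powRM ?(ltW l0) ?invr_ge0 ?powR_ge0// invfM mulrC.
  congr (_ * _).
  by rewrite -[(W e `^ r)^-1]powRN -powRN -powRrM; congr (_ `^ _); field; rewrite gt_eqF.
have VD : V e / D e @[e --> 0^'+] --> (1 : R).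
  rewrite -[X in _ --> X](mul1r 1).
  apply: cvg_trans (cvgM (noise_equiv beta_gt0 r_gt0 gamma_ge0 FF Woo) Wl).
  apply: near_eq_cvg; apply: filterS small => e [e0 e1 We0 l0 _].
  rewrite /V /D -/a /=; field.
  by rewrite !gt_eqF// powR_gt0.
have BD : B e / D e @[e --> 0^'+] --> (0 : R).
  rewrite -[X in _ --> X](_ : a / 2 * (0 * 1) = 0); last by rewrite mul0r mulr0.
  have BW := bias_negligible beta_gt0 r_gt0 gamma_ge0 L_gt0 W_sol.
  apply: cvg_trans (cvgMl_tmp (a := a / 2) (cvgM BW Wl)).
  apply: near_eq_cvg; apply: filterS small => e [e0 e1 We0 l0 _].
  rewrite /B /D -/a /=; field.
  by rewrite !gt_eqF// powR_gt0.
have sD : fine (s e) / D e @[e --> 0^'+] --> (1 : R).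
  have BVD : B e / D e + V e / D e @[e --> 0^'+] --> (1 : R).
    by rewrite -[X in _ --> X](add0r 1); exact: (cvgD BD VD).
  apply: squeeze_cvgr VD BVD; apply: filterS2 small sVB => e [_ _ _ _ D0] [_ Vs sB].
  by rewrite -mulrDl !ler_pM2r ?invr_gt0// Vs sB.
exists (fun e => fine (s e) / D e - 1).
  by rewrite -[X in _ --> X](subrr 1); apply: cvgB; [exact: sD|exact: cvg_cst].
apply: filterS2 small sVB => e [_ _ _ _ D0] [fs _ _].
rewrite -/(s e) -/a -/(l e) -/(D e) [1 + _]addrC subrK.
by rewrite mulrCA divff ?mulr1 ?fineK// gt_eqF.
Unshelve. all: by end_near. Qed.
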